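(* Let $p$ be a prime and $n$ a positive integer. Let $G=\prod_{i=1}^k\mathbb{Z}_{p^{\alpha_i}}$ and $H=\prod_{j=1}^r\mathbb{Z}_{p^{\beta_j}}$ (direct products of cyclic groups) be two finite abelian $p$-groups of order $p^n$, where $1\le\alpha_1\le\alpha_2\le\dots\le\alpha_k$ and $1\le\beta_1\le\beta_2\le\dots\le\beta_r$ are integers (so $\sum_{i=1}^k\alpha_i=\sum_{j=1}^r\beta_j=n$). Then $$\psi'(G)<\psi'(H)\iff(\alpha_k,\dots,\alpha_1,\underbrace{0,\dots,0}_{n-k\text{ positions}})\prec(\beta_r,\dots,\beta_1,\underbrace{0,\dots,0}_{n-r\text{ positions}}).$$
   Context: For a finite group $G$, $\psi'(G)=\prod_{x\in G}o(x)$ denotes the product of the orders of all elements of $G$, where $o(x)$ is the order of $x\in G$. $\mathbb{Z}_m$ denotes the cyclic group of order $m$. Let $P_n=\{(x_1,\dots,x_n)\in\mathbb{N}^n\mid x_1\ge x_2\ge\dots\ge x_n,\ x_1+x_2+\dots+x_n=n\}$ (with $0\in\mathbb{N}$) be the set of partitions of $n$, totally ordered by the lexicographic order, whose strict part $\prec$ is defined by: $(x_1,\dots,x_n)\prec(y_1,\dots,y_n)$ if and only if there is some $m\in\{0,1,\dots,n-1\}$ with $x_1=y_1,\dots,x_m=y_m$ and $x_{m+1}<y_{m+1}$. *)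

(* Defs.v *)
From mathcomp Require Import all_boot all_fingroup all_algebra.

Set Implicit Arguments.
Unset Strict Implicit.
Unset Printing Implicit Defensive.

Import GroupScope.

Definition psi' (gT : finGroupType) (G : {group gT}) : nat :=
  (\prod_(x in G) #[x])%N.

(* The group law of 'Z_m is addition modulo m when 1 < m; here m = p ^ a_i,
   so all the a_i have to be positive. *)
Definition cyclic_prod (p k : nat) (a : k.-tuple nat) : finGroupType :=
  {dffun forall i : 'I_k, ('Z_(p ^ tnth a i) : finGroupType)}.

Definition in_partitions (n : nat) (x : n.-tuple nat) : bool :=
  sorted geq x && (\sum_(i < n) tnth x i == n)%N.

(* Defined on all n-tuples; by pad_rev_partition below it is only ever applied
   to partitions of n. *)
Definition prec (n : nat) (x y : n.-tuple nat) : Prop :=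
  exists m : 'I_n,
    (forall i : 'I_n, (i < m)%N -> tnth x i = tnth y i) /\
    (tnth x m < tnth y m)%N.

(* Reverses a and pads it with zeros up to length n; see pad_revE. *)
Definition pad_rev (n k : nat) (a : k.-tuple nat) : n.-tuple nat :=
  [tuple nth 0%N (rev a) i | i < n].

Lemma pad_revE n k (a : k.-tuple nat) :
  (k <= n)%N -> pad_rev n a = rev a ++ nseq (n - k) 0%N :> seq nat.
Proof.
move=> le_kn; apply: (@eq_from_nth _ 0%N) => [|i].
  by rewrite size_tuple size_cat size_rev size_nseq size_tuple subnKC.
rewrite size_tuple => ltin.
rewrite -[i]/(val (Ordinal ltin)) -tnth_nth tnth_mktuple /=.
rewrite nth_cat size_rev size_tuple; case: ltnP => // ki.
by rewrite nth_nseq if_same nth_default // size_rev size_tuple.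
Qed.

Lemma card_cyclic_prod p k (a : k.-tuple nat) :
  prime p -> (forall i, 0 < tnth a i)%N ->
  #|[set: cyclic_prod p a]| = (p ^ \sum_(i < k) tnth a i)%N.
Proof.
move=> p_pr a_gt0; rewrite cardsT card_dep_ffun foldrE big_map -big_enum /=.
rewrite expn_sum; apply: eq_bigr => i _.
rewrite card_ord Zp_cast // -(exp1n (tnth a i)) ltn_exp2r ?prime_gt1 //.
Qed.

Lemma sum_ge_size k (a : k.-tuple nat) :
  (forall i, 0 < tnth a i)%N -> (k <= \sum_(i < k) tnth a i)%N.
Proof.
move=> a_gt0; rewrite -[leqLHS]muln1 -{1}(card_ord k) -sum_nat_const.
exact: leq_sum.
Qed.

Lemma pad_rev_partition n k (a : k.-tuple nat) :
  (forall i, 0 < tnth a i)%N -> sorted leq a -> (\sum_(i < k) tnth a i)%N = n ->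
  in_partitions (pad_rev n a).
Proof.
move=> a_gt0 a_sorted a_sum; have := sum_ge_size a_gt0; rewrite a_sum => le_kn.
apply/andP; split; last first.
  rewrite -(big_tuple _ _ _ xpredT id) pad_revE //= big_cat /= big_nseq.
  rewrite iter_addn_0 mul0n addn0 (perm_big a) ?perm_rev //=.
  by rewrite big_tuple a_sum.
have geq_trans : transitive geq by move=> y x z /= ? ?; apply: (@leq_trans y).
rewrite pad_revE // sorted_pairwise // pairwise_cat -!sorted_pairwise //.
rewrite rev_sorted a_sorted; apply/and3P; split=> //.
  by apply/allrelP => x y _ /nseqP[-> _].
by elim: (n - k)%N => //= m; case: m.
Qed.

(* Main.v *)
(* Writing N_j(G) for the number of x in G with x ^ (p ^ j) = 1, counting the
   p-power steps below each order gives
     psi'(G) = p ^ (\sum_(j < n) (p ^ n - N_j(G))),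
   so a larger psi' means a smaller \sum_j N_j.  For the partition x of n that
   describes G, N_j(G) = p ^ (T x j) with T x j = \sum_i min(x_i, j).  Suppose x
   and y first differ at m, with x_m < y_m, and put b = y_m - 1.  Then
   T x j = T y j for j > b, while T y b < T x b, and T y is strictly increasing
   on [0, b]; hence the geometric bound
     \sum_(j <= b) p ^ (T y j) < p ^ (T y b + 1) <= p ^ (T x b)
   gives \sum_j p ^ (T y j) < \sum_j p ^ (T x j). *)

Require Import Defs.
From mathcomp Require Import all_boot all_fingroup all_algebra.
From mathcomp Require Import cyclic pgroup abelian.

Set Implicit Arguments.
Unset Strict Implicit.
Unset Printing Implicit Defensive.

Lemma ltn_sum_witness (I : finType) (F G : I -> nat) (i0 : I) :
  (forall i, F i <= G i) -> F i0 < G i0 -> \sum_i F i < \sum_i G i.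
Proof.
move=> leFG ltFG; rewrite (bigD1 i0) //= [ltnRHS](bigD1 i0) //=.
by rewrite -addSn leq_add // leq_sum.
Qed.

(** Induction on [b]: the terms before the last sum to less than [p ^ (f b).+1 <= p ^ f b.+1], so
    the whole sum stays below [2 * p ^ f b.+1], and [2 <= p]. *)
Lemma sum_expn_lt (p b : nat) (f : nat -> nat) :
  1 < p -> (forall j, j < b -> f j < f j.+1) ->
  \sum_(j < b.+1) p ^ f j < p ^ (f b).+1.
Proof.
move=> p_gt1; elim: b => [|b IHb] f_incr.
  by rewrite big_ord1 ltn_exp2l.
rewrite big_ord_recr /=.
have /IHb lt_sum : forall j, j < b -> f j < f j.+1.
  by move=> j ltjb; apply: f_incr; apply: ltnW.
apply: (@leq_trans (2 * p ^ f b.+1)); last by rewrite expnS leq_mul2r p_gt1 orbT.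
rewrite mul2n -addnn -addSn leq_add2r (leq_trans lt_sum) //.
by rewrite leq_exp2l // f_incr.
Qed.

(** This is [T x j]; for a partition [x] it is the sum of the first [j] parts of the conjugate
    partition. *)
Definition trunc_sum (n : nat) (x : n.-tuple nat) (j : nat) : nat :=
  \sum_(i < n) minn (tnth x i) j.

Section Partitions.

Variable n : nat.
Implicit Types x y : n.-tuple nat.

Lemma in_partitions_anti x (i j : 'I_n) :
  in_partitions x -> i <= j -> tnth x j <= tnth x i.
Proof.
case/andP=> x_sorted _ le_ij; rewrite !(tnth_nth 0).
have geq_trans : transitive geq by move=> b a c /= ? ?; apply: (@leq_trans b).
apply: (sorted_leq_nth geq_trans _ _ x_sorted) => //.
- by move=> a /=.
- by rewrite inE size_tuple.
- by rewrite inE size_tuple.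
Qed.

Lemma in_partitions_leq x (i : 'I_n) : in_partitions x -> tnth x i <= n.
Proof. by case/andP=> _ /eqP sum_x; rewrite -[leqRHS]sum_x (bigD1 i) //= leq_addr. Qed.

(** Each part [a] splits as [minn a j + (a - j)]. Truncated sums can thus be compared through the
    excesses [a - j], which vanish once [a <= j]. *)
Lemma trunc_sum_excess x j :
  in_partitions x -> trunc_sum x j + \sum_(i < n) (tnth x i - j) = n.
Proof.
case/andP=> _ /eqP sum_x; rewrite -[RHS]sum_x -big_split; apply: eq_bigr => i _ /=.
by rewrite minnE subnK ?leq_subr.
Qed.

Lemma trunc_sum_ltS x (i : 'I_n) j :
  j < tnth x i -> trunc_sum x j < trunc_sum x j.+1.
Proof.
move=> ltj; apply: (ltn_sum_witness (i0 := i)) => [k|].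
  by rewrite leq_min geq_minl (leq_trans (geq_minr _ _)).
by rewrite (minn_idPr (ltnW ltj)) (minn_idPr ltj).
Qed.

Lemma prec_sum_expn (p : nat) x y :
    1 < p -> in_partitions x -> in_partitions y -> prec x y ->
  \sum_(j < n) p ^ trunc_sum y j < \sum_(j < n) p ^ trunc_sum x j.
Proof.
move=> p_gt1 px py [m [eq_xy lt_m]].
have y_gt0 : 0 < tnth y m by apply: leq_ltn_trans lt_m.
(* The last [j] at which the truncated sums differ: at [b], part [m] of [y] still has excess 1,
   while [x] has none from [m] on. *)
pose b := (tnth y m).-1.
have bS : b.+1 = tnth y m by rewrite prednK.
have le_bn : b.+1 <= n by rewrite bS; apply: in_partitions_leq.
have x_small (i : 'I_n) : m <= i -> tnth x i <= b.
  by move=> lemi; rewrite -ltnS bS (leq_ltn_trans (in_partitions_anti px lemi)).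
(* Before [m] the parts agree; from [m] on the excesses over [j] are zero on both sides. *)
have eqT j : b.+1 <= j -> trunc_sum y j = trunc_sum x j.
  move=> lebj; apply/eqP.
  rewrite -(eqn_add2r (\sum_(i < n) (tnth y i - j))) trunc_sum_excess //.
  rewrite (_ : \sum_(i < n) _ = \sum_(i < n) (tnth x i - j)).
    by rewrite trunc_sum_excess.
  apply: eq_bigr => i _; case: (ltnP i m) => [/eq_xy-> // | lemi].
  have /eqP-> : tnth y i - j == 0.
    by rewrite subn_eq0 (leq_trans (in_partitions_anti py lemi)) // -bS.
  by apply/esym/eqP; rewrite subn_eq0 (leq_trans (x_small i lemi)) // ltnW.
have ltT : trunc_sum y b < trunc_sum x b.
  rewrite -(ltn_add2r (\sum_(i < n) (tnth y i - b))) trunc_sum_excess //.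
  rewrite -{1}(trunc_sum_excess b px) ltn_add2l.
  apply: (ltn_sum_witness (i0 := m)) => [i|].
    case: (ltnP i m) => [/eq_xy-> // | /x_small].
    by rewrite -subn_eq0 => /eqP->.
  by rewrite -bS subSnn ltnS leqn0 subn_eq0 x_small.
(* Cut both sums at [b.+1]: the tails cancel by [eqT], and in the head for [x] the last term alone
   suffices. *)
rewrite -!(big_mkord xpredT (fun j => p ^ trunc_sum _ j)).
rewrite !(big_cat_nat (leq0n _) le_bn) /=.
rewrite [X in _ + X < _](_ : _ = \sum_(b.+1 <= j < n) p ^ trunc_sum x j); last first.
  by apply: eq_big_nat => j /andP[lebj _]; rewrite eqT.
rewrite ltn_add2r !big_mkord.
apply: (@leq_trans (p ^ (trunc_sum y b).+1)).
  apply: sum_expn_lt => // j ltjb; apply: (trunc_sum_ltS (i := m)).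
  by rewrite -bS ltnS ltnW.
apply: (@leq_trans (p ^ trunc_sum x b)); first by rewrite leq_exp2l.
by rewrite big_ord_recr /= leq_addl.
Qed.

(** Decided at the least index where the tuples differ. Totality lets [prec_sum_expn] yield both
    directions of the theorem. *)
Lemma prec_total x y : [\/ x = y, prec x y | prec y x].
Proof.
have [i0 neq_i0|eq_xy] := pickP (fun i => tnth x i != tnth y i); last first.
  by constructor 1; apply: eq_from_tnth => i; apply/eqP/negbFE/eq_xy.
case: (@arg_minnP _ i0 (fun i => tnth x i != tnth y i) val neq_i0) => m neq_m min_m.
have eq_xy (i : 'I_n) : i < m -> tnth x i = tnth y i.
  by apply: contraTeq; rewrite -leqNgt => /min_m.
case: ltngtP neq_m => // lt_m _; [constructor 2 | constructor 3]; exists m; split=> //.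
by move=> i /eq_xy.
Qed.

End Partitions.

Lemma card_Ldiv_isog (gT hT : finGroupType) (G : {group gT}) (H : {group hT}) m :
  (G \isog H -> #|'Ldiv_m(G)| = #|'Ldiv_m(H)|)%g.
Proof.
case/isogP=> f injf <-; rewrite -injm_Ldiv // card_injm //.
exact: subsetIl.
Qed.

(** With [e = logn p #[x]], the solutions form the subgroup generated by [x ^+ (p ^ (e - j))], whose
    order has exponent [e - (e - j) = minn e j], also when [e < j]. *)
Lemma card_Ldiv_cycle (gT : finGroupType) (p j : nat) (x : gT) :
  prime p -> (p.-elt x)%g ->
  #|('Ldiv_(p ^ j)(<[x]>))%g| = p ^ minn (logn p #[x]%g) j.
Proof.
move=> p_pr p_x; rewrite -OhmEabelian //; last first.
  by apply: abelianS (Ohm_sub _ _) _; apply: cycle_abelian.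
by rewrite (Ohm_p_cycle _ p_x) -orderE (orderXexp _ (card_pgroup p_x)) minnE.
Qed.

(** Powers are taken coordinatewise, so the solution set is the product of those in the cyclic
    factors. *)
Lemma card_Ldiv_cyclic_prod (p k j : nat) (a : k.-tuple nat) :
    prime p -> (forall i, 0 < tnth a i) ->
  #|('Ldiv_(p ^ j)([set: cyclic_prod p a]))%g|
    = p ^ \sum_(i < k) minn (tnth a i) j.
Proof.
move=> p_pr a_gt0.
pose L i : {set 'Z_(p ^ tnth a i)} := ('Ldiv_(p ^ j)([set: 'Z_(p ^ tnth a i)]))%g.
have -> : ('Ldiv_(p ^ j)([set: cyclic_prod p a]) = setXn L)%g.
  apply/setP=> x; rewrite in_setXn.
  have expE i m : ((x ^+ m) i = x i ^+ m)%g.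
    by elim: m => [|m IHm]; rewrite ?expg0 ?oneg_ffun // !expgS mulg_ffun IHm.
  apply/LdivP/forallP => [[_ xm1] i | xL].
    by apply/LdivP; split; rewrite ?inE -?expE ?xm1 ?oneg_ffun.
  by split=> //; apply/ffunP=> i; have /LdivP[_] := xL i; rewrite -expE oneg_ffun.
rewrite /setXn cardsE card_family foldrE big_map -big_enum /= expn_sum.
apply: eq_bigr => i _.
have pa_gt1 : 1 < p ^ tnth a i.
  by rewrite -(exp1n (tnth a i)) ltn_exp2r // prime_gt1.
have o1 : #[Zp1 : 'Z_(p ^ tnth a i)]%g = p ^ tnth a i.
  by rewrite order_Zp1 Zp_cast.
rewrite /L Zp_cycle card_Ldiv_cycle // ?o1 ?pfactorK //.
by rewrite /p_elt o1 pnatX pnat_id.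
Qed.

(** Double counting: an [x] of order [p ^ e] lies in ['Ldiv_(p ^ j)(G)] for exactly [n - e] of the
    [j < n], so it contributes [p ^ e * p ^ (n - e) = p ^ n]. The product form avoids subtraction in
    the exponent. *)
Lemma psi'_pgroup (gT : finGroupType) (G : {group gT}) (p n : nat) :
  prime p -> #|G| = p ^ n ->
  psi' G * p ^ (\sum_(j < n) #|('Ldiv_(p ^ j)(G))%g|) = p ^ (n * #|G|).
Proof.
move=> p_pr oG.
rewrite (eq_bigr (fun j : 'I_n => \sum_(x in G) (x ^+ (p ^ j) == 1)%g)); last first.
  move=> j _; rewrite -sum1dep_card big_mkcond /= [RHS]big_mkcond /=.
  by apply: eq_bigr => x _; rewrite !inE; case: (x \in G); case: eqP.
rewrite exchange_big expn_sum /psi' -big_split /= expnM -prod_nat_const.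
apply: eq_bigr => x Gx.
have /(dvdn_pfactor _ _ p_pr)[e le_en ox] : #[x]%g %| p ^ n.
  by rewrite -oG order_dvdG.
rewrite ox -expnD; congr (p ^ _).
rewrite (eq_bigr (fun j : 'I_n => (e <= j) : nat)); last first.
  by move=> j _; rewrite -order_dvdn ox dvdn_Pexp2l // prime_gt1.
rewrite -(big_mkord xpredT (fun j => (e <= j) : nat)) (big_cat_nat _ le_en) //=.
rewrite big_nat big1 => [|j /andP[_ ltje]]; last by rewrite leqNgt ltje.
rewrite big_nat (eq_bigr (fun=> 1)) => [|j /andP[->]//].
by rewrite -big_nat sum_nat_const_nat muln1 add0n subnKC.
Qed.

Lemma trunc_sum_pad_rev (n k : nat) (a : k.-tuple nat) j :
  k <= n -> trunc_sum (pad_rev n a) j = \sum_(i < k) minn (tnth a i) j.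
Proof.
move=> le_kn; rewrite /trunc_sum.
rewrite -(big_tuple _ _ (pad_rev n a) xpredT (fun v => minn v j)).
rewrite -(big_tuple _ _ a xpredT (fun v => minn v j)) pad_revE // big_cat /=.
rewrite big_nseq min0n iter_addn_0 mul0n addn0.
by apply: perm_big; rewrite perm_rev.
Qed.

Theorem theoremC (p n k r : nat) (alpha : k.-tuple nat) (beta : r.-tuple nat)
    (gT hT : finGroupType) (G : {group gT}) (H : {group hT}) :
  prime p -> (0 < n)%N ->
  (forall i : 'I_k, (1 <= tnth alpha i)%N) -> sorted leq alpha ->
  (forall j : 'I_r, (1 <= tnth beta j)%N) -> sorted leq beta ->
  G \isog [set: cyclic_prod p alpha] -> H \isog [set: cyclic_prod p beta] ->
  #|G| = (p ^ n)%N -> #|H| = (p ^ n)%N ->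
  (psi' G < psi' H)%N <-> prec (pad_rev n alpha) (pad_rev n beta).
Proof.
move=> p_pr _ a_gt0 a_sorted b_gt0 b_sorted isoG isoH oG oH.
have p_gt1 := prime_gt1 p_pr.
have part K (c : K.-tuple nat) (KT : finGroupType) (M : {group KT}) :
    (forall i, 1 <= tnth c i) -> sorted leq c ->
    M \isog [set: cyclic_prod p c] -> #|M| = p ^ n ->
  in_partitions (pad_rev n c) /\
  psi' M * p ^ (\sum_(j < n) p ^ trunc_sum (pad_rev n c) j) = p ^ (n * p ^ n).
  move=> c_gt0 c_sorted isoM oM.
  have sum_c : \sum_(i < K) tnth c i = n.
    apply: (@expnI p) => //.
    by rewrite -card_cyclic_prod // -oM (card_isog isoM).
  split; first exact: pad_rev_partition.
  rewrite -[in RHS]oM -(psi'_pgroup p_pr oM); congr (_ * p ^ _).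
  apply: eq_bigr => j _; rewrite (card_Ldiv_isog _ isoM) card_Ldiv_cyclic_prod //.
  by rewrite trunc_sum_pad_rev // -[leqRHS]sum_c sum_ge_size.
have [partG psiG] := part _ _ _ _ a_gt0 a_sorted isoG oG.
have [partH psiH] := part _ _ _ _ b_gt0 b_sorted isoH oH.
set S := \sum_(j < n) _ in psiG; set S' := \sum_(j < n) _ in psiH.
(* Both identities have the same right-hand side, so after multiplying by [p ^ S] the factor
   [psi' H] cancels and only exponents remain. *)
have psi_lt : (psi' G < psi' H) = (S' < S).
  have psiH_gt0 : 0 < psi' H by apply: prodn_gt0 => x; apply: order_gt0.
  rewrite -(ltn_pmul2r (m := p ^ S)) ?expn_gt0 ?prime_gt0 //.
  by rewrite psiG -psiH ltn_pmul2l // ltn_exp2l.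
rewrite psi_lt; split=> [lt_S|]; last exact: prec_sum_expn.
(* Equal partitions would give [S = S'], and the reverse order [S < S']. *)
case: (prec_total (pad_rev n alpha) (pad_rev n beta)) => // [eq_ab|].
  by move: lt_S; rewrite /S /S' eq_ab ltnn.
by move/(prec_sum_expn p_gt1 partH partG); rewrite ltnNge ltnW.
Qed.
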